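(* Given two 3-manifold triangulations $\mathcal{T}$ and $\mathcal{T}'$, their isomorphism signatures satisfy $\sigma(\mathcal{T}) = \sigma(\mathcal{T}')$ if and only if $\mathcal{T}$ and $\mathcal{T}'$ are isomorphic.
   Context: A 3-manifold triangulation of size $n$ is a collection of $n$ abstract tetrahedra whose $4n$ faces are affinely identified in $2n$ pairs so that the resulting space is a connected closed 3-manifold. Faces of the same tetrahedron may be identified with each other. Two triangulations are isomorphic if they are identical up to relabelling tetrahedra and reordering the four vertices of each tetrahedron. A labelling of a triangulation of size $n$ numbers its tetrahedra $0,\dots,n-1$ and numbers the four vertices of each tetrahedron $0,\dots,3$; the faces of each tetrahedron are numbered so that face $i$ is opposite vertex $i$. Let $A_{t,f}\in\{0,\dots,n-1\}$ denote the tetrahedron glued to face $f$ of tetrahedron $t$. The labelling is canonical if, in the sequence $A_{0,0},A_{0,1},A_{0,2},A_{0,3},A_{1,0},\dots,A_{n-1,3}$: (i) for each $1\leq i<j$, tetrahedron $i$ first appears before tetrahedron $j$ first appears; and (ii) for each $i\geq 1$, if tetrahedron $i$ first appears as the entry $A_{t,f}=i$, then the corresponding gluing uses the identity map: face $f$ of tetrahedron $t$ is glued to face $f$ of tetrahedron $i$ so that vertex $v$ of tetrahedron $t$ maps to vertex $v$ of tetrahedron $i$ for each $v\neq f$. A triangulation of size $n$ has exactly $24n$ canonical labellings. The isomorphism signature $\sigma(\mathcal{T})$ is obtained by encoding, for each canonical labelling of $\mathcal{T}$, the full set of face gluings (the table giving, for each tetrahedron $t$ and face $f$, the adjacent tetrahedron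 and the images of the three vertices of the face) as a sequence of bits, using a fixed direct encoding from which the table can be recovered, and taking the lexicographically smallest of these $24n$ bit sequences. *)

(* Defs.v *)
From HB Require Import structures.
From Stdlib Require Import Relations.
From mathcomp Require Import all_boot all_order all_algebra all_fingroup generic_quotient.
From mathcomp Require Import all_classical all_reals all_analysis.

Set Implicit Arguments.
Unset Strict Implicit.
Unset Printing Implicit Defensive.

Import Order.TTheory GRing.Theory Num.Theory.
Import numFieldNormedType.Exports.
Local Open Scope quotient_scope.
Local Open Scope classical_set_scope.
Local Open Scope ring_scope.

(** Face [f] of a tetrahedron is the one opposite vertex [f].  The affine
    bijection from face [f] of tetrahedron [t] to a face of tetrahedron
    [adj t f] is determined by the images of the three vertices [v != f].  It is
    stored as the unique permutation of the four vertices that extends it: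
    [gperm t f] sends [v != f] to the image of [v], and hence sends [f] to the
    number of the target face. *)

Record gluing (n : nat) := Gluing {
  adj : 'I_n -> 'I_4 -> 'I_n;
  gperm : 'I_n -> 'I_4 -> 'S_4;
  adjK : forall t f, adj (adj t f) (gperm t f f) = t;
  gpermK : forall t f, gperm (adj t f) (gperm t f f) = (gperm t f)^-1%g;
  glue_neq : forall t f, (adj t f, gperm t f f) != (t, f)
}.

Section Realization.
Variables (R : realType) (n : nat) (G : gluing n).

(* barycentric coordinates *)
Definition simplex3 : set 'rV[R]_4 :=
  [set x | (forall v, 0 <= x 0 v) /\ \sum_v x 0 v = 1].

Definition tetrahedra : topologicalType := {t : 'I_n & set_type simplex3}.

Definition face_identified (p q : tetrahedra) : Prop :=
  exists f : 'I_4,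
    [/\ tag q = adj G (tag p) f,
        set_val (tagged p) 0 f = 0 &
        forall v, set_val (tagged q) 0 (gperm G (tag p) f v)
                  = set_val (tagged p) 0 v].

Definition identified (p q : tetrahedra) : bool :=
  `[< clos_refl_sym_trans tetrahedra face_identified p q >].

Lemma identified_refl : reflexive identified.
Proof. by move=> p; apply/asboolP; exact: rst_refl. Qed.

Lemma identified_sym : symmetric identified.
Proof. by move=> p q; apply/asboolP/asboolP; exact: rst_sym. Qed.

Lemma identified_trans : transitive identified.
Proof. by move=> q p r /asboolP pq /asboolP qr; apply/asboolP/(rst_trans _ _ _ q). Qed.

Canonical identified_equiv :=
  EquivRel identified identified_refl identified_sym identified_trans.

Definition realization : topologicalType :=
  quotient_topology {eq_quot identified_equiv}.

End Realization.

Definition homeomorphic (X Y : topologicalType) : Prop :=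
  exists (f : X -> Y) (g : Y -> X),
    [/\ continuous f, continuous g, cancel f g & cancel g f].

Definition locally_euclidean (R : realType) (d : nat) (X : topologicalType) :
    Prop :=
  forall x : X, exists (U : set X) (V : set 'rV[R]_d),
    [/\ open U, U x, open V & homeomorphic (set_type U) (set_type V)].

(* Closed means compact without boundary; a connected space is nonempty. *)
Record connected_closed_manifold (R : realType) (d : nat)
    (X : topologicalType) : Prop := {
  manifold_hausdorff : hausdorff_space X;
  manifold_second_countable : @second_countable X;
  manifold_locally_euclidean : locally_euclidean R d X;
  manifold_compact : compact [set: X];
  manifold_nonempty : [set: X] !=set0;
  manifold_connected : connected [set: X]
}.

Record triangulation (R : realType) (n : nat) := Triangulation {
  triangulation_gluing :> gluing n;
  triangulation_manifold :
    connected_closed_manifold R 3 (realization R triangulation_gluing)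
}.

Definition isomorphic (n n' : nat) (G : gluing n) (G' : gluing n') : Prop :=
  exists (phi : 'I_n -> 'I_n') (p : 'I_n -> 'S_4),
    [/\ bijective phi,
        forall t f, adj G' (phi t) (p t f) = phi (adj G t f) &
        forall t f v, v != f ->
          gperm G' (phi t) (p t f) (p t v) = p (adj G t f) (gperm G t f v)].

(** A labelling [l] gives number [l.1 t] to tetrahedron [t], and number
    [l.2 t v] to vertex [v] of tetrahedron [t].  The product of permutations is
    the one of the library: [(s * u)%g x = u (s x)]. *)

Definition labelling (n : nat) : finType := ('S_n * {ffun 'I_n -> 'S_4})%type.

Section Relabel.
Variables (n : nat) (l : labelling n) (G : gluing n).

Definition old_tet (t : 'I_n) : 'I_n := (l.1^-1)%g t.

Definition old_vertex (t : 'I_n) (v : 'I_4) : 'I_4 := ((l.2 (old_tet t))^-1)%g v.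

Definition relabel_adj (t : 'I_n) (f : 'I_4) : 'I_n :=
  l.1 (adj G (old_tet t) (old_vertex t f)).

Definition relabel_gperm (t : 'I_n) (f : 'I_4) : 'S_4 :=
  ((l.2 (old_tet t))^-1 * gperm G (old_tet t) (old_vertex t f)
   * l.2 (adj G (old_tet t) (old_vertex t f)))%g.

Lemma relabel_gpermE t f : relabel_gperm t f f =
  l.2 (adj G (old_tet t) (old_vertex t f))
      (gperm G (old_tet t) (old_vertex t f) (old_vertex t f)).
Proof. by rewrite /relabel_gperm !permM. Qed.

Lemma old_relabel_adj t f :
  old_tet (relabel_adj t f) = adj G (old_tet t) (old_vertex t f).
Proof. by rewrite /old_tet /relabel_adj permK. Qed.

Lemma old_relabel_gperm t f :
  old_vertex (relabel_adj t f) (relabel_gperm t f f)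
  = gperm G (old_tet t) (old_vertex t f) (old_vertex t f).
Proof. by rewrite /old_vertex old_relabel_adj relabel_gpermE permK. Qed.

Lemma relabel_adjK t f : relabel_adj (relabel_adj t f) (relabel_gperm t f f) = t.
Proof.
by rewrite /relabel_adj old_relabel_gperm old_relabel_adj adjK permKV.
Qed.

Lemma relabel_gpermK t f :
  relabel_gperm (relabel_adj t f) (relabel_gperm t f f)
  = (relabel_gperm t f)^-1%g.
Proof.
rewrite {1}/relabel_gperm old_relabel_gperm old_relabel_adj adjK gpermK.
by rewrite /relabel_gperm !invMg invgK mulgA.
Qed.

Lemma relabel_glue_neq t f : (relabel_adj t f, relabel_gperm t f f) != (t, f).
Proof.
apply: contraNneq (glue_neq G (old_tet t) (old_vertex t f)) => -[Et Ef].
by rewrite -old_relabel_adj -old_relabel_gperm Ef Et.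
Qed.

Definition relabel : gluing n :=
  Gluing relabel_adjK relabel_gpermK relabel_glue_neq.

End Relabel.

Definition adj_seq (n : nat) (G : gluing n) : seq 'I_n :=
  [seq adj G t f | t <- enum 'I_n, f <- enum 'I_4].

(* Entry (t, f) of the table is the item of [adj_seq] at position 4t + f. *)
Definition first_pos (n : nat) (G : gluing n) (i : 'I_n) : nat :=
  index i (adj_seq G).

Definition is_canonical (n : nat) (G : gluing n) : bool :=
  [forall i : 'I_n, forall j : 'I_n,
     (0 < i < j)%N ==> (first_pos G i < first_pos G j)%N]
  && [forall t : 'I_n, forall f : 'I_4,
        (0 < adj G t f)%N && (first_pos G (adj G t f) == 4 * t + f)%N ==>
        [forall v : 'I_4, (v != f) ==> (gperm G t f v == v)]].

Definition canonical_labelling (n : nat) (G : gluing n) (l : labelling n) :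
  bool := is_canonical (relabel l G).

(* Entry (t, f) holds the tetrahedron adjacent to face f of t, and the images
   of the three vertices v != f in increasing order of v. *)
Definition gluing_table (n : nat) : Type :=
  {ffun 'I_n * 'I_4 -> 'I_n * 3.-tuple 'I_4}.

Definition table_of (n : nat) (G : gluing n) : gluing_table n :=
  [ffun tf => (adj G tf.1 tf.2,
               [tuple gperm G tf.1 tf.2 (lift tf.2 k) | k < 3])].

(* The bit encoding is a parameter; all that is asked of it is that the table,
   including its size, can be recovered. *)
Record encoding := Encoding {
  encode : forall n, gluing_table n -> bitseq;
  decode : bitseq -> {n : nat & gluing_table n};
  encodeK : forall n (G : gluing n),
    decode (encode (table_of G)) = existT gluing_table n (table_of G)
}.

Lemma encoding_inhabited : inhabited encoding.
Proof.
pose tables : countType :=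
  {n : nat & {ffun 'I_n * 'I_4 -> 'I_n * 3.-tuple 'I_4}}.
pose enc n (tb : gluing_table n) :=
  nseq (pickle (existT gluing_table n tb : tables)) true.
pose default := existT gluing_table 0%N (finfun (fun tf => (tf.1, [tuple 0 | k < 3]))).
pose dec (s : bitseq) : {n : nat & gluing_table n} :=
  odflt (default : tables) (unpickle (size s)).
have decK n (G : gluing n) :
    dec (enc n (table_of G)) = existT gluing_table n (table_of G).
  by rewrite /dec /enc size_nseq pickleK.
by exists; exact: (Encoding decK).
Qed.

Definition canonical_codes (enc : encoding) (n : nat) (G : gluing n) :
    seq (seqlexi bool) :=
  [seq encode enc (table_of (relabel l G))
    | l <- enum (labelling n) & canonical_labelling G l].

(* The default value is never used for a triangulation, because every
   triangulation has a canonical labelling. *)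
Definition signature (enc : encoding) (n : nat) (G : gluing n) : bitseq :=
  head [::] (sort (@Order.le _ (seqlexi bool)) (canonical_codes enc G)).

(* Main.v *)
Require Import Defs.
From mathcomp Require Import all_boot all_order all_algebra.
From mathcomp Require Import all_classical all_reals all_analysis.
From mathcomp Require Import all_fingroup generic_quotient zify.

(** The signature is the minimum of a set of codes that depends only on the
    isomorphism class, because the relabellings of a gluing are exactly the
    gluings isomorphic to it with the same index set; and a code determines its
    table.  What remains is that canonical labellings exist.  Connectedness of
    the realization makes the dual graph connected, since the union of the
    tetrahedra in a set closed under adjacency is open and closed.  A canonical
    labelling is then built by scanning the table entry by entry: an entry that
    shows a tetrahedron for the first time has its label swapped with the least
    unseen one and its vertices renamed so that the gluing becomes the identity,
    which leaves all earlier entries unchanged. *)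

Set Implicit Arguments.
Unset Strict Implicit.
Unset Printing Implicit Defensive.

(** * Gluings and their tables *)

(** [u^-1 (s x)] cannot be some [y != x], since then [s y = u y = s x]. At the vertex opposite a
    face, this recovers [gperm] from the images of the three face vertices. *)
Lemma perm_eq_except (T : finType) (x : T) (s u : {perm T}) :
  (forall y, y != x -> s y = u y) -> s = u.
Proof.
move=> su; apply/permP => y; have [->|/su//] := eqVneq y x.
have [e|/[dup] /su + nx] := eqVneq ((u^-1)%g (s x)) x.
  by rewrite -{2}e permKV.
by rewrite permKV => /perm_inj e; rewrite e eqxx in nx.
Qed.

Lemma gluing_ext (n : nat) (G G' : gluing n) :
  adj G =2 adj G' -> gperm G =2 gperm G' -> G = G'.
Proof.
case: G G' => [a p h1 h2 h3] [a' p' h1' h2' h3'] /= ea ep.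
have {}ea : a = a' by apply/funext => t; exact/funext/ea.
have {}ep : p = p' by apply/funext => t; exact/funext/ep.
by subst; congr Gluing; exact: Prop_irrelevance.
Qed.

Lemma table_of_inj (n : nat) : injective (@table_of n).
Proof.
move=> G G' /ffunP e.
have {}e t f : adj G t f = adj G' t f /\ gperm G t f = gperm G' t f.
  move: (e (t, f)); rewrite !ffunE /= => -[-> eg]; split=> //.
  apply: (@perm_eq_except _ f) => v; rewrite eq_sym => /unlift_some[k -> _].
  have: forall k, tnth [tuple gperm G t f (lift f k) | k < 3] k
                = tnth [tuple gperm G' t f (lift f k) | k < 3] k.
    by move=> j; congr tnth; exact: val_inj.
  by move/(_ k); rewrite !tnth_mktuple.
by apply: gluing_ext => t f; case: (e t f).
Qed.

(** * Isomorphism and relabelling *)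

Section Isomorphism.
Variables (n n' : nat) (G : gluing n) (G' : gluing n').

(** Agreement on the three vertices of a face forces agreement at the opposite one, so the condition
    becomes an identity in the group ['S_4], where it can be cancelled. *)
Lemma isomorphic_gperm (phi : 'I_n -> 'I_n') (p : 'I_n -> 'S_4) t f :
  (forall v, v != f ->
    gperm G' (phi t) (p t f) (p t v) = p (adj G t f) (gperm G t f v)) ->
  (p t * gperm G' (phi t) (p t f) = gperm G t f * p (adj G t f))%g.
Proof.
by move=> h; apply: (@perm_eq_except _ f) => v /h; rewrite !permM.
Qed.

Lemma isomorphic_size : isomorphic G G' -> n = n'.
Proof. by case=> phi [p [/bij_eq_card]]; rewrite !card_ord. Qed.

Lemma isomorphic_sym : isomorphic G G' -> isomorphic G' G.
Proof.
case=> phi [p [[psi phiK psiK] Ha Hg]].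
exists psi, (fun t => (p (psi t))^-1%g).
have Ea t f : adj G (psi t) ((p (psi t))^-1%g f) = psi (adj G' t f).
  by rewrite -{3}(psiK t) -{2}(permKV (p (psi t)) f) Ha phiK.
split; [by exists phi | exact: Ea |] => t f v _.
have /isomorphic_gperm/permP/(_ ((p (psi t))^-1%g v)) :=
  Hg (psi t) ((p (psi t))^-1%g f).
by rewrite !permM !permKV psiK Ea => ->; rewrite permK.
Qed.

Lemma isomorphic_trans (n'' : nat) (G'' : gluing n'') :
  isomorphic G G' -> isomorphic G' G'' -> isomorphic G G''.
Proof.
case=> phi [p [bphi Ha Hg]] [psi [q [bpsi Ka Kg]]].
exists (psi \o phi), (fun t => p t * q (phi t))%g; split=> [|t f|t f v vf].
- exact: bij_comp.
- by rewrite permM Ka Ha.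
- by rewrite !permM Kg ?(inj_eq perm_inj)// Hg// Ha.
Qed.

End Isomorphism.

(** On one index set, a bijection with a vertex permutation for each tetrahedron is the same data as
    a labelling. *)
Lemma isomorphic_relabelP (n : nat) (G G' : gluing n) :
  isomorphic G G' <-> exists l, G' = relabel l G.
Proof.
split=> [[phi [p [bphi Ha Hg]]]|[[s p] ->]].
  exists (perm (bij_inj bphi), [ffun t => p t]).
  have old t : phi (old_tet (perm (bij_inj bphi), [ffun t => p t]) t) = t.
    by rewrite /old_tet /= -{2}(permKV (perm (bij_inj bphi)) t) permE.
  apply: gluing_ext => t f /=.
    rewrite /relabel_adj /old_vertex /= permE -Ha old !ffunE.
    by rewrite permKV.
  rewrite /relabel_gperm /old_vertex /= !ffunE.
  set u := old_tet _ t.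
  have /isomorphic_gperm := Hg u ((p u)^-1%g f).
  by rewrite old permKV -mulgA => <-; rewrite mulKg.
exists s, (fun t => p t).
split=> [|t f|t f v _] /=; first exact: (Bijective (permK s) (permKV s)).
  by rewrite /relabel_adj /old_vertex /old_tet /= !permK.
by rewrite /relabel_gperm /old_vertex /old_tet /= !permK !permM !permK.
Qed.

Lemma isomorphic_refl (n : nat) (G : gluing n) : isomorphic G G.
Proof. by exists id, (fun=> 1%g); split=> *; rewrite ?perm1//; exists id. Qed.

(** * Codes and their minimum *)

(** No labelling occurs in this description, so invariance of the set of codes reduces to symmetry
    and transitivity of [isomorphic]. *)
Lemma canonical_codesP (enc : encoding) (n : nat) (G : gluing n) (s : bitseq) :
  reflect (exists G' : gluing n,
             [/\ isomorphic G G', is_canonical G' & s = encode enc (table_of G')])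
          (s \in canonical_codes enc G).
Proof.
apply: (iffP mapP) => [[l + ->]|[G' [/isomorphic_relabelP[l ->] cG' ->]]].
  rewrite mem_filter => /andP[cl _]; exists (relabel l G); split=> //.
  by apply/isomorphic_relabelP; exists l.
by exists l; rewrite // mem_filter [canonical_labelling _ _]cG' mem_enum.
Qed.

Lemma head_sort_le_mem (d : Order.disp_t) (T : orderType d) (x : T) (s : seq T) :
  s != [::] -> head x (sort <=%O s) \in s.
Proof.
rewrite -size_eq0 -(size_sort <=%O s) -(mem_sort <=%O s).
by case: (sort _ _) => //= a l _; rewrite mem_head.
Qed.

(** Each head lies in the other sorted list, so the two heads bound each other. *)
Lemma eq_mem_head_sort_le (d : Order.disp_t) (T : orderType d) (x : T)
    (s1 s2 : seq T) :
  s1 =i s2 -> head x (sort <=%O s1) = head x (sort <=%O s2).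
Proof.
move=> e; have {e} : sort <=%O s1 =i sort <=%O s2.
  by move=> y; rewrite !mem_sort.
have := Order.TotalTheory.sort_le_sorted s1.
have := Order.TotalTheory.sort_le_sorted s2.
case: (sort _ s1) (sort _ s2) => [|a u] [|b v] //=.
- by move=> _ _ /(_ b); rewrite mem_head.
- by move=> _ _ /(_ a); rewrite mem_head.
rewrite !Order.POrderTheory.le_path_sortedE /=.
move=> /andP[/allP bv _] /andP[/allP au _] e.
apply/Order.POrderTheory.le_anti/andP; split.
- by have := mem_head b v; rewrite -e inE => /predU1P[->|/au].
- by have := mem_head a u; rewrite e inE => /predU1P[->|/bv].
Qed.

(** * Connectedness of the dual graph *)

(** Phrased by adjacency-closed sets rather than paths, so that it applies directly to unions of
    tetrahedra and to initial segments of labels. *)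
Definition face_connected (n : nat) (G : gluing n) : Prop :=
  forall S : {set 'I_n}, (forall t f, t \in S -> adj G t f \in S) ->
    S != finset.set0 -> S = finset.setT.

Lemma isomorphic_face_connected (n n' : nat) (G : gluing n) (G' : gluing n') :
  isomorphic G G' -> face_connected G -> face_connected G'.
Proof.
case=> phi [p [[psi phiK psiK] Ha _]] cG S clS /set0Pn[x xS].
have e : (phi @^-1: S)%SET = finset.setT.
  apply: cG => [t f|]; first by rewrite !inE -Ha; exact: clS.
  by apply/set0Pn; exists (psi x); rewrite inE psiK.
apply/setP => y; have : psi y \in finset.setT by rewrite inE.
by rewrite -e !inE psiK.
Qed.

Section Topology.
Import GRing.Theory Num.Theory.
Local Open Scope classical_set_scope.
Local Open Scope ring_scope.
Local Open Scope quotient_scope.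

Lemma open_tag (I : choiceType) (X : I -> topologicalType) (P : pred I) :
  open [set p : {i & X i} | P (tag p)].
Proof.
apply/sigT_openP => i; change (open [set _ : X i | P i]).
case: (P i); first by rewrite (_ : mkset _ = setT); [exact: openT|apply/seteqP; split].
by rewrite (_ : mkset _ = set0); [exact: open0|apply/seteqP; split].
Qed.

Variables (R : realType) (n : nat) (G : gluing n).

(** An elementary identification passes to an adjacent tetrahedron, and [adjK] leads back. *)
Lemma identified_closed (S : {set 'I_n}) (p q : tetrahedra R n) :
  (forall t f, t \in S -> adj G t f \in S) ->
  identified G p q -> (tag p \in S) = (tag q \in S).
Proof.
move=> clS /asboolP; elim=> // {p q} [p q [f [-> _ _]]|p q r _ -> _ -> //].
apply/idP/idP => [|aS]; first exact: clS.
by rewrite -(adjK G (tag p) f); exact: clS.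
Qed.

Lemma identified_repr (p : tetrahedra R n) :
  identified G p (repr (\pi_({eq_quot (identified_equiv R G)}) p)).
Proof. by have /eqmodP := esym (reprK (\pi_({eq_quot (identified_equiv R G)}) p)). Qed.

Lemma vertex_in_simplex3 : @simplex3 R (delta_mx 0 0).
Proof.
split=> [v|]; first by rewrite mxE ler0n.
rewrite (bigD1 0)//= big1 ?mxE ?eqxx ?addr0// => v v0.
by rewrite mxE (negPf v0) andbF.
Qed.

(** A point over each index, through which statements on the realization return to indices. *)
Definition tet_vertex (t : 'I_n) : tetrahedra R n :=
  existT _ t (SigSub (mem_set vertex_in_simplex3)).

Lemma face_connected_realization :
  connected [set: realization R G] -> face_connected G.
Proof.
move=> cR S clS /set0Pn[x xS].
pose pi (p : tetrahedra R n) : realization R G :=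
  \pi_({eq_quot (identified_equiv R G)}) p.
(* [B A] tests the chosen representative; by [piB] any other gives the same answer when [A] is [S]
   or its complement. *)
pose B (A : {set 'I_n}) : set (realization R G) :=
  [set y | tag (repr y) \in A].
have piB (A : {set 'I_n}) p :
    A = S \/ A = finset.setC S -> B A (pi p) = (tag p \in A).
  rewrite /B /= => -[] ->.
    by rewrite -(identified_closed clS (identified_repr p)).
  by rewrite !inE -(identified_closed clS (identified_repr p)).
have oB (A : {set 'I_n}) : A = S \/ A = finset.setC S -> open (B A).
  move=> eA; change (open (pi @^-1` B A)).
  rewrite (_ : _ @^-1` _ = [set p : tetrahedra R n | tag p \in A]).
    exact: open_tag.
  by apply/seteqP; split=> p /=; rewrite piB.
have BT : B S = setT.
  apply: cR.
  - by exists (pi (tet_vertex x)); rewrite piB//; left.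
  - by exists (B S); rewrite ?setTI//; apply: oB; left.
  (* [B S] is closed because its complement is [B] of the complement of [S]. *)
  - exists (B S); rewrite ?setTI// -openC.
    rewrite (_ : ~` _ = B (finset.setC S)); first by apply: oB; right.
    by apply/seteqP; split=> y /=; rewrite /B/= inE => /negP.
apply/setP => t; rewrite inE; suff : tag (tet_vertex t) \in S by [].
by rewrite -piB ?BT//; left.
Qed.
End Topology.

(** * Existence of a canonical labelling, by scanning the table *)

Lemma nth_allpairs (S T U : Type) (x0 : U) (y : S) (z : T) (g : S -> T -> U)
    (s : seq S) (r : seq T) i j :
  i < size s -> j < size r ->
  nth x0 [seq g a b | a <- s, b <- r] (size r * i + j)
  = g (nth y s i) (nth z r j).
Proof.
move=> + jr; elim: s i => [|a s IH] [|i]//= si.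
  by rewrite muln0 nth_cat size_map jr (nth_map z).
rewrite nth_cat size_map mulnS -addnA ltnNge leq_addr /= addKn.
exact: IH.
Qed.

Lemma first_posE (n : nat) (G : gluing n) (t : 'I_n) (f : 'I_4) :
  (forall (t' : 'I_n) (f' : 'I_4),
     4 * t' + f' < 4 * t + f -> adj G t' f' != adj G t f) ->
  first_pos G (adj G t f) = 4 * t + f.
Proof.
move=> before; rewrite /first_pos.
have nthE (u : 'I_n) (g : 'I_4) : nth t (adj_seq G) (4 * u + g) = adj G u g.
  have := @nth_allpairs _ _ _ t t f (adj G) (enum 'I_n) (enum 'I_4) u g.
  by rewrite !size_enum_ord !nth_ord_enum => ->.
have sz : size (adj_seq G) = n * 4 by rewrite size_allpairs !size_enum_ord.
set q := index _ _.
have pq : q <= 4 * t + f.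
  rewrite leqNgt; apply/negP => /(before_find t) /=.
  by rewrite nthE eqxx.
apply/eqP; rewrite eqn_leq pq leqNgt; apply/negP => lt.
have qn : q < n * 4 by have := ltn_ord t; have := ltn_ord f; lia.
(* The index [q] is read back as row [q %/ 4] and column [q %% 4]. *)
have q4 : q %/ 4 < n by rewrite ltn_divLR.
have := before (Ordinal q4) (Ordinal (ltn_pmod q (isT : 0 < 4))).
rewrite -nthE /= mulnC -divn_eq => /(_ lt).
by rewrite nth_index ?eqxx// -index_mem -/q sz.
Qed.

(* The labels seen in the first [k] entries, together with 0, are 0, ..., m. *)
Definition canonical_upto (n : nat) (G : gluing n) (k m : nat) : Prop :=
  (forall (t : 'I_n) (f : 'I_4), 4 * t + f < k -> adj G t f <= m) /\
  (forall i : 'I_n, 0 < i <= m -> exists (t : 'I_n) (f : 'I_4),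
     [/\ 4 * t + f < k, adj G t f = i, gperm G t f = 1%g &
         forall (t' : 'I_n) (f' : 'I_4),
           4 * t' + f' < 4 * t + f -> adj G t' f' < i]).

Lemma table_pos_inj (n : nat) (t u : 'I_n) (f g : 'I_4) :
  4 * t + f = 4 * u + g -> t = u /\ f = g.
Proof.
by move=> e; have := ltn_ord f; have := ltn_ord g; split; apply: val_inj => /=; lia.
Qed.

(** The labels up to [m] form an adjacency-closed set, nonempty because it contains 0. *)
Lemma face_connected_prefix (n : nat) (G : gluing n) (m : nat) (t : 'I_n) :
  face_connected G ->
  (forall (u : 'I_n) (f : 'I_4), u <= m -> adj G u f <= m) -> t <= m.
Proof.
move=> cG cl; have : t \in [set x : 'I_n | x <= m]%SET; last by rewrite inE.
rewrite (cG [set x : 'I_n | x <= m]%SET) ?inE// => [x g|].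
  by rewrite !inE; exact: cl.
apply/set0Pn; exists (Ordinal (leq_ltn_trans (leq0n t) (ltn_ord t))).
by rewrite inE.
Qed.

(** If [m < t], rows 0 to [m] are fully scanned, so the labels up to [m] are closed under adjacency
    and hence include [t]. *)
Lemma canonical_upto_row (n : nat) (G : gluing n) (m : nat) (t : 'I_n) (f : 'I_4) :
  face_connected G -> canonical_upto G (4 * t + f) m -> t <= m.
Proof.
move=> cG [seen _]; rewrite leqNgt; apply/negP => mt.
suff : t <= m by rewrite leqNgt mt.
apply: face_connected_prefix cG _ => u g um.
by apply: seen; have := ltn_ord g; lia.
Qed.

Lemma canonical_upto_step (n : nat) (G : gluing n) (m : nat) (t : 'I_n) (f : 'I_4) :
  face_connected G -> m < n -> canonical_upto G (4 * t + f) m ->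
  exists (G' : gluing n) (m' : nat),
    [/\ isomorphic G G', m' < n & canonical_upto G' (4 * t + f).+1 m'].
Proof.
move=> cG mn Gkm; have tm := canonical_upto_row cG Gkm.
case: Gkm => seen new.
have row_le (u : 'I_n) (g : 'I_4) : 4 * u + g <= 4 * t + f -> u <= m.
  by have := ltn_ord f; lia.
(* An entry showing a label already seen requires no change. *)
have [bm|bm] := leqP (adj G t f) m.
  exists G, m; split; [exact: isomorphic_refl | by [] | split].
    move=> u g; rewrite ltnS leq_eqVlt => /predU1P[/table_pos_inj[-> ->]//|].
    exact: seen.
  move=> i /new[u [g [lt]]]; exists u, g; split=> //; exact: ltnW.
have m1n : m.+1 < n by apply: leq_ltn_trans bm (ltn_ord _).
pose b := adj G t f; pose b' := Ordinal m1n.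
(* The new gluing at this entry is [gperm G t f * l.2 b], so the inverse makes it the identity. *)
pose l : labelling n :=
  (tperm b b', [ffun x => if x == b then (gperm G t f)^-1%g else 1%g]).
(* Both [b] and [b'] exceed [m], so [l] fixes the tetrahedra up to [m], [t] among them, with their
   vertices. *)
have bne (u : 'I_n) : u <= m -> (u == b) = false.
  by move=> um; apply/eqP => e; move: bm; rewrite -/b -e; lia.
have b'ne (u : 'I_n) : u <= m -> (u == b') = false.
  by move=> um; apply/eqP => /(congr1 val) /=; lia.
have oldE (u : 'I_n) : u <= m -> old_tet l u = u.
  by move=> um; rewrite /old_tet /= tpermV tpermD// eq_sym ?bne ?b'ne.
have vertE (u : 'I_n) g : u <= m -> old_vertex l u g = g.
  by move=> um; rewrite /old_vertex oldE// ffunE bne// invg1 perm1.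
have adjE (u : 'I_n) g : u <= m -> adj (relabel l G) u g = tperm b b' (adj G u g).
  by move=> um; rewrite /= /relabel_adj oldE// vertE.
have gpermE (u : 'I_n) g : u <= m ->
    gperm (relabel l G) u g = (gperm G u g * l.2 (adj G u g))%g.
  by move=> um; rewrite /= /relabel_gperm oldE// vertE// ffunE bne// invg1 mul1g.
have adj_old (u : 'I_n) (g : 'I_4) : 4 * u + g < 4 * t + f ->
    adj (relabel l G) u g = adj G u g.
  move=> lt; have am := seen _ _ lt.
  by rewrite adjE ?(row_le _ g (ltnW lt))// tpermD// eq_sym ?bne ?b'ne.
exists (relabel l G), m.+1; split=> //.
  by apply/isomorphic_relabelP; exists l.
split=> [u g|i].
  rewrite ltnS leq_eqVlt => /predU1P[/table_pos_inj[-> ->]|lt].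
    by rewrite adjE// tpermL.
  by rewrite adj_old// leqW// seen.
(* A label up to [m] keeps its witness, whose target is not [b]; for [m.+1] the entry at [(t, f)] is
   the witness. *)
have [im /andP[i0 _]|im] := leqP i m.
  case: (new i); rewrite ?i0// => u [g [lt Ea Eg bef]].
  exists u, g; split=> [||| u' g' lt'].
  - exact: ltnW.
  - by rewrite adj_old.
  - rewrite gpermE ?(row_le _ g (ltnW lt))// Eg Ea mul1g.
    by rewrite ffunE bne.
  - by rewrite adj_old ?bef//; apply: ltn_trans lt.
move=> /andP[_ im1]; have {im im1} -> : i = b' by apply: val_inj => /=; lia.
exists t, f; split=> [//|||u g lt].
- by rewrite adjE// tpermL.
- by rewrite gpermE// ffunE eqxx mulgV.
- by rewrite adj_old// ltnS seen.
Qed.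

Lemma canonical_upto_full (n : nat) (G : gluing n) (m : nat) :
  face_connected G -> canonical_upto G (4 * n) m -> is_canonical G.
Proof.
move=> cG [seen new].
have full (t : 'I_n) : t <= m.
  apply: face_connected_prefix cG _ => u g _.
  by apply: seen; have := ltn_ord u; have := ltn_ord g; lia.
have {}new (i : 'I_n) : 0 < i -> exists (t : 'I_n) (f : 'I_4),
    [/\ adj G t f = i, gperm G t f = 1%g, first_pos G i = 4 * t + f &
        forall (t' : 'I_n) (f' : 'I_4),
          4 * t' + f' < 4 * t + f -> adj G t' f' < i].
  move=> i0; have /new : 0 < i <= m by rewrite i0 full.
  move=> [t [f [_ Ea Eg bef]]]; exists t, f; split=> //.
  rewrite -Ea first_posE// => t' f' /bef; rewrite Ea.
  by apply: contraTneq => ->; rewrite ltnn.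
apply/andP; split.
  apply/forallP => i; apply/forallP => j; apply/implyP => /andP[i0 ij].
  have [t [f [Ei _ -> bef]]] := new _ i0.
  have [u [g [Ej _ -> _]]] := new _ (ltn_trans i0 ij).
  (* If [j] appeared before the witness of [i], then [bef] would give [j < i]. *)
  rewrite ltnNge leq_eqVlt; apply/negP => /predU1P[/table_pos_inj[e1 e2]|].
    by move: ij; rewrite -Ei -Ej e1 e2 ltnn.
  by move/bef; rewrite Ej ltnNge (ltnW ij).
apply/forallP => t; apply/forallP => f; apply/implyP => /andP[/new].
move=> [u [g [_ Eg -> _]]] /eqP/table_pos_inj[<- <-].
by apply/forallP => v; rewrite Eg perm1 eqxx implybT.
Qed.

Lemma exists_canonical (n : nat) (G : gluing n) :
  face_connected G -> exists2 G' : gluing n, isomorphic G G' & is_canonical G'.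
Proof.
case: (posnP n) => [n0|n0 cG].
  (* Without tetrahedra the conditions are vacuous; the bound [m < n] below requires [0 < n]. *)
  exists G; first exact: isomorphic_refl.
  by apply/andP; split; apply/forallP => i; have := ltn_ord i; rewrite {2}n0.
suff [G' [m [iG mn Gm]]] : exists (G' : gluing n) (m : nat),
    [/\ isomorphic G G', m < n & canonical_upto G' (4 * n) m].
  by exists G' => //; exact: canonical_upto_full (isomorphic_face_connected iG cG) Gm.
have : 4 * n <= 4 * n by [].
(* Induction on the number [k] of scanned entries, kept within the table by [k <= 4 * n]; it starts
   with [m = 0]. *)
elim: {1 3}(4 * n) => [_|k IH kn].
  by exists G, 0; split; [exact: isomorphic_refl | | split=> // i; lia].
have [G' [m [iG mn Gkm]]] := IH (ltnW kn).
have kq : k %/ 4 < n by rewrite ltn_divLR// mulnC.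
pose t := Ordinal kq; pose f := Ordinal (ltn_pmod k (isT : 0 < 4)).
have ek : k = 4 * t + f by rewrite /= mulnC -divn_eq.
rewrite ek in Gkm *.
have [G'' [m' [iG' m'n Gkm']]] :=
  canonical_upto_step (isomorphic_face_connected iG cG) mn Gkm.
by exists G'', m'; split=> //; exact: isomorphic_trans iG iG'.
Qed.

(** * The signature as a complete invariant *)

Lemma isomorphic_signature (enc : encoding) (n n' : nat) (G : gluing n)
    (G' : gluing n') :
  isomorphic G G' -> signature enc G = signature enc G'.
Proof.
move=> iG; have en := isomorphic_size iG; subst n'.
apply: (@eq_mem_head_sort_le _ (seqlexi bool)) => s.
apply/canonical_codesP/canonical_codesP => -[G0 [i0 c0 e0]]; exists G0; split=> //.
- exact: isomorphic_trans (isomorphic_sym iG) i0.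
- exact: isomorphic_trans iG i0.
Qed.

(** A canonical labelling exists, so the list of codes is nonempty and its sorted head is a code,
    not the default. *)
Lemma signature_mem (enc : encoding) (n : nat) (G : gluing n) :
  face_connected G -> exists2 G' : gluing n,
    isomorphic G G' & signature enc G = encode enc (table_of G').
Proof.
move=> /exists_canonical[G0 i0 c0].
have mem0 : (encode enc (table_of G0) : seqlexi bool) \in canonical_codes enc G.
  by apply/canonical_codesP; exists G0.
have : signature enc G \in canonical_codes enc G.
  by apply: (@head_sort_le_mem _ (seqlexi bool)); apply: contraTneq mem0 => ->.
by case/canonical_codesP => G1 [i1 _ e1]; exists G1.
Qed.

Lemma encode_table_isomorphic (enc : encoding) (n n' : nat) (G : gluing n)
    (G' : gluing n') :
  encode enc (table_of G) = encode enc (table_of G') -> isomorphic G G'.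
Proof.
move=> /(congr1 (Defs.decode enc)); rewrite !encodeK => e.
(* The decoded pair carries the size; once [n = n'], the two tables live in one type and can be
   compared. *)
have en : n = n' := congr1 tag e; subst n'.
by have /table_of_inj -> := eq_from_Tagged e; exact: isomorphic_refl.
Qed.

Lemma triangulation_face_connected (R : realType) (n : nat)
  (T : triangulation R n) : face_connected T.
Proof.
exact: face_connected_realization (manifold_connected (triangulation_manifold T)).
Qed.

Theorem theorem3p3 (R : realType) (enc : encoding) (n n' : nat)
    (T : triangulation R n) (T' : triangulation R n') :
  signature enc T = signature enc T' <-> isomorphic T T'.
Proof.
split; last exact: isomorphic_signature.
(* Each signature is the code of a gluing isomorphic to its triangulation, so equal codes link [T]
   and [T']. *)
have [G iG ->] := signature_mem enc (@triangulation_face_connected _ _ T).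
have [G' iG' ->] := signature_mem enc (@triangulation_face_connected _ _ T').
move=> /encode_table_isomorphic eG; apply: isomorphic_trans iG _.
exact: isomorphic_trans eG (isomorphic_sym iG').
Qed.
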